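(* Let $X$ and $Y$ be Banach spaces and let $\mathcal{E}$ be a normalized $1$-unconditional basic sequence. (a) If $X$ and $Y$ are coarsely equivalent, then $(\oplus X)_{\mathcal{E}}$ and $(\oplus Y)_{\mathcal{E}}$ are coarsely equivalent. (b) If $X$ and $Y$ are uniformly homeomorphic, then $(\oplus X)_{\mathcal{E}}$ and $(\oplus Y)_{\mathcal{E}}$ are uniformly homeomorphic. (c) If $X$ and $Y$ are simultaneously homeomorphically and coarsely equivalent, then $(\oplus X)_{\mathcal{E}}$ and $(\oplus Y)_{\mathcal{E}}$ are simultaneously homeomorphically and coarsely equivalent.
   Context: For a map $f:(M,d)\to(N,\partial)$ between metric spaces and $t\ge 0$, let $\omega_f(t)=\sup\{\partial(f(x),f(y)) : d(x,y)\le t\}$ and $\rho_f(t)=\inf\{\partial(f(x),f(y)) : d(x,y)\ge t\}$ (with $\inf\emptyset=\infty$). $f$ is coarse if $\omega_f(t)<\infty$ for all $t\ge 0$; expanding if $\lim_{t\to\infty}\rho_f(t)=\infty$; a coarse equivalence if it is coarse, expanding, and cobounded, i.e. $\sup_{y\in N}\partial(y,f(M))<\infty$. A uniform homeomorphism is a bijection $f$ with $f$ and $f^{-1}$ uniformly continuous. Two spaces are coarsely equivalent (resp. uniformly homeomorphic) if there is a coarse equivalence (resp. uniform homeomorphism) between them; they are simultaneously homeomorphically and coarsely equivalent if there is a single map between them which is both a homeomorphism (onto) and a coarse equivalence. If $\mathcal{E}=(e_n)_{n\in\mathbb{N}}$ is a $1$-unconditional basic sequence and $X$ is a Banach space, $(\oplus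 X)_{\mathcal{E}}$ is the Banach space of sequences $(x_n)_n$ in $X$ for which $\sum_n\|x_n\|e_n$ converges, with norm $\|(x_n)_n\|=\left\|\sum_n\|x_n\|e_n\right\|$. Normalized means $\|e_n\|=1$ for all $n$. *)

(* Defs.v *)
From HB Require Import structures.
From mathcomp Require Import all_boot all_order all_algebra.
From mathcomp Require Import all_classical all_reals all_analysis.
From mathcomp Require Import ring lra.

Set Implicit Arguments.
Unset Strict Implicit.
Unset Printing Implicit Defensive.

Import Order.TTheory GRing.Theory Num.Theory.
Import numFieldNormedType.Exports.

Local Open Scope classical_set_scope.
Local Open Scope ring_scope.

(** The notions of large-scale geometry below are stated for normed spaces,
    seen as metric spaces for the distance [`|x - y|]: [modulus f] is
    $\omega_f$ and [comodulus f] is $\rho_f$. *)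

Definition modulus (R : realType) (V W : normedModType R) (f : V -> W)
    (t : R) : \bar R :=
  ereal_sup [set (`|f p.1 - f p.2|)%:E | p in [set p : V * V | `|p.1 - p.2| <= t]].

Definition comodulus (R : realType) (V W : normedModType R) (f : V -> W)
    (t : R) : \bar R :=
  ereal_inf [set (`|f p.1 - f p.2|)%:E | p in [set p : V * V | t <= `|p.1 - p.2|]].

Definition coarse (R : realType) (V W : normedModType R) (f : V -> W) : Prop :=
  forall t : R, 0 <= t -> (modulus f t < +oo)%E.

Definition expanding (R : realType) (V W : normedModType R) (f : V -> W) : Prop :=
  comodulus f t @[t --> +oo%R] --> +oo%E.

Definition cobounded (R : realType) (V W : normedModType R) (f : V -> W) : Prop :=
  (ereal_sup [set ereal_inf [set (`|y - f x|)%:E | x in [set: V]]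
             | y in [set: W]] < +oo)%E.

Definition coarse_equivalence (R : realType) (V W : normedModType R)
    (f : V -> W) : Prop :=
  [/\ coarse f, expanding f & cobounded f].

Definition homeomorphism (V W : topologicalType) (f : V -> W) : Prop :=
  exists g : W -> V,
    [/\ cancel f g, cancel g f, continuous f & continuous g].

Definition uniform_homeomorphism (V W : uniformType) (f : V -> W) : Prop :=
  exists g : W -> V,
    [/\ cancel f g, cancel g f, unif_continuous f & unif_continuous g].

Definition coarsely_equivalent (R : realType) (V W : normedModType R) : Prop :=
  exists f : V -> W, coarse_equivalence f.

Definition uniformly_homeomorphic (V W : uniformType) : Prop :=
  exists f : V -> W, uniform_homeomorphism f.

Definition homeomorphically_coarsely_equivalent (R : realType)
    (V W : normedModType R) : Prop :=
  exists f : V -> W, homeomorphism f /\ coarse_equivalence f.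

Definition closed_span (R : realType) (Z : normedModType R) (e : nat -> Z) :
    set Z :=
  closure [set z | exists (n : nat) (a : nat -> R), z = \sum_(i < n) a i *: e i].

(** [e] is a Schauder basis of its closed linear span. *)
Definition basic_sequence (R : realType) (Z : normedModType R) (e : nat -> Z) :
    Prop :=
  forall z : Z, closed_span e z ->
    exists! a : nat -> R, series (fun n => a n *: e n) @ \oo --> z.

(** [K] bounds the norms of all the changes of signs on finite combinations. *)
Definition unconditional_basic_sequence (R : realType) (Z : normedModType R)
    (K : R) (e : nat -> Z) : Prop :=
  basic_sequence e /\
  forall (n : nat) (a : nat -> R) (s : nat -> bool),
    `|\sum_(i < n) ((-1) ^+ s i * a i) *: e i|
      <= K * `|\sum_(i < n) a i *: e i|.

Record unconditional1 (R : realType) (Z : completeNormedModType R) := {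
  unconditional1_seq :> nat -> Z;
  unconditional1P : unconditional_basic_sequence 1 unconditional1_seq
}.

Section unconditional.
Context {R : realType} {Z : completeNormedModType R} (E : unconditional1 Z).
Implicit Types (a b c : nat -> R).

Let uncond n a (s : nat -> bool) :
  `|\sum_(i < n) ((-1) ^+ s i * a i) *: E i| <= `|\sum_(i < n) a i *: E i|.
Proof. by rewrite -[leRHS]mul1r; exact: (unconditional1P E).2. Qed.

(** The bound extends from signs to multipliers in [[-1, 1]], by convexity in
    one coordinate at a time. *)
Let contract n b k (t : nat -> R) :
  (forall i, `|t i| <= 1) ->
  (forall i, (k <= i)%N -> exists s : bool, t i = (-1) ^+ s) ->
  `|\sum_(i < n) (t i * b i) *: E i| <= `|\sum_(i < n) b i *: E i|.
Proof.
elim: k t => [|k IH] t t1 tk.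
  have ts i : {s : bool | t i = (-1) ^+ s} by apply: cid; exact: tk.
  under eq_bigr => i _ do rewrite (projT2 (ts i)).
  exact: (uncond n b (fun i => projT1 (ts i))).
pose u (r : R) i := if i == k then r else t i.
have uk r : `|r| <= 1 -> (exists s : bool, r = (-1) ^+ s) ->
    `|\sum_(i < n) (u r i * b i) *: E i| <= `|\sum_(i < n) b i *: E i|.
  move=> r1 rs; apply: IH => i; rewrite /u; case: eqP => // /eqP ik ki.
  by apply: tk; rewrite ltn_neqAle eq_sym ik.
have u1 := uk 1 _ (ex_intro _ false erefl).
have uN1 := uk (-1) _ (ex_intro _ true erefl).
rewrite normr1 lexx in u1; rewrite normrN1 lexx in uN1.
pose l : R := (1 + t k) / 2.
have /ler_normlP[tk1 tk2] := t1 k.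
have l0 : 0 <= l by rewrite /l; lra.
have l1 : 0 <= 1 - l by rewrite /l; lra.
have -> : \sum_(i < n) (t i * b i) *: E i =
    l *: (\sum_(i < n) (u 1 i * b i) *: E i) +
    (1 - l) *: (\sum_(i < n) (u (-1) i * b i) *: E i).
  rewrite !scaler_sumr -big_split/=; apply: eq_bigr => i _.
  rewrite !scalerA -scalerDl; congr (_ *: _); rewrite /u /l.
  by case: eqP => [->|_]; field.
have nZ (r : R) (z : Z) : 0 <= r -> `|r *: z| = r * `|z|.
  by move=> r0; rewrite normrZ ger0_norm.
rewrite (le_trans (ler_normD _ _))// !nZ//.
have := ler_wpM2l l0 (u1 isT); have := ler_wpM2l l1 (uN1 isT); lra.
Qed.

Lemma unconditional1_le a b m n : (forall i, `|a i| <= `|b i|) ->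
  `|\sum_(m <= i < n) a i *: E i| <= `|\sum_(m <= i < n) b i *: E i|.
Proof.
move=> ab; pose cut c i := if (m <= i)%N then c i else 0.
have cutE c : \sum_(m <= i < n) c i *: E i = \sum_(i < n) cut c i *: E i.
  rewrite -(big_mkord xpredT (fun i => cut c i *: E i)).
  have [mn|nm] := leqP m n.
    rewrite [RHS](@big_cat_nat _ _ _ m 0 n)//= [X in _ = X + _]big_nat.
    rewrite [X in _ = X + _]big1 ?add0r.
      by apply: eq_big_nat => i /andP[mi _]; rewrite /cut mi.
    by move=> i /andP[_ im]; rewrite /cut leqNgt im scale0r.
  rewrite [LHS]big_geq ?(ltnW nm)// [RHS]big_nat [RHS]big1// => i /andP[_ im].
  by rewrite /cut leqNgt (ltn_trans im nm) scale0r.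
rewrite !cutE; pose t i := if (i < n)%N then cut a i / cut b i else 1.
have -> : \sum_(i < n) cut a i *: E i = \sum_(i < n) (t i * cut b i) *: E i.
  apply: eq_bigr => i _; congr (_ *: _); rewrite /t ltn_ord /cut.
  case: ifP => _; last by rewrite mulr0.
  have [b0|b0] := eqVneq (b i) 0; last by rewrite divfK.
  by rewrite b0 mulr0; apply/eqP; rewrite -normr_le0 (le_trans (ab i))// b0 normr0.
apply: (@contract n _ n t) => i; rewrite /t.
  case: ifP => _; last by rewrite normr1.
  rewrite /cut; case: ifP => _; last by rewrite mul0r normr0.
  have [b0|b0] := eqVneq (b i) 0; first by rewrite b0 invr0 mulr0 normr0.
  by rewrite normrM normfV ler_pdivrMr ?normr_gt0// mul1r.
by move=> ni; rewrite ltnNge ni; exists false.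
Qed.

Lemma unconditional1_cvg a b : (forall i, `|a i| <= `|b i|) ->
  cvgn (series (fun n => b n *: E n)) -> cvgn (series (fun n => a n *: E n)).
Proof.
move=> ab /cauchy_cvgP/cauchy_seriesP bc.
apply/cauchy_cvgP/cauchy_seriesP => e /bc.
apply: filterS => n /=; apply: le_lt_trans.
exact: (@unconditional1_le a b).
Qed.

Lemma unconditional1_lim a b : (forall i, `|a i| <= `|b i|) ->
  cvgn (series (fun n => b n *: E n)) ->
  `|limn (series (fun n => a n *: E n))| <=
  `|limn (series (fun n => b n *: E n))|.
Proof.
move=> ab bc; have ac := unconditional1_cvg ab bc.
rewrite -!lim_norm//; apply: ler_lim; [exact: is_cvg_norm|exact: is_cvg_norm|].
by apply: nearW => n /=; exact: unconditional1_le.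
Qed.

Lemma unconditional1_neq0 n : E n != 0.
Proof.
apply/eqP => En0.
have span0 : closed_span E 0.
  by apply: subset_closure; exists 0%N, (fun=> 0); rewrite big_ord0.
have [a [_ aP]] := (unconditional1P E).1 0 span0.
have zero (c : nat -> R) : (forall i, c i *: E i = 0) ->
    series (fun i => c i *: E i) @ \oo --> (0 : Z).
  move=> c0; rewrite (_ : series _ = cst 0); first exact: cvg_cst.
  by apply/funext => k; rewrite /series/= big1// => i _.
have a0 := aP (fun=> 0) (zero _ (fun i => scale0r _)).
have a1 := aP (fun i => (i == n)%:R) (zero _ _).
have {}a1 : a = (fun i => (i == n)%:R).
  by apply: a1 => i; case: eqP => [->|_]; rewrite ?En0 ?scaler0 ?scale0r.
have := congr1 (fun f => f n) (etrans (esym a0) a1).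
by rewrite eqxx => /eqP; rewrite eq_sym oner_eq0.
Qed.

Lemma unconditional1_coord a n : cvgn (series (fun i => a i *: E i)) ->
  `|a n| * `|E n| <= `|limn (series (fun i => a i *: E i))|.
Proof.
move=> ac; pose c i := if i == n then a n else 0.
have ca i : `|c i| <= `|a i|.
  by rewrite /c; case: eqP => [->//|_]; rewrite normr0.
rewrite (le_trans _ (unconditional1_lim ca ac))//.
rewrite (_ : limn _ = a n *: E n) ?normrZ//.
apply: cvg_lim => //; apply: cvg_near_cst; exists n.+1 => // k /= nk.
rewrite /series/= big_mkord (bigD1 (Ordinal nk))//= {1}/c eqxx big1 ?addr0//.
by move=> i; rewrite -val_eqE/= /c => /negPf ->; rewrite scale0r.
Qed.

End unconditional.

Section direct_sum.
Context {R : realType} {Z : completeNormedModType R}.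

Definition summable_seq (X : normedModType R) (E : unconditional1 Z) :
    {pred nat -> X} :=
  fun x => `[< cvgn (series (fun n => `|x n| *: E n)) >].

(** [direct_sum X E] is $(\oplus X)_E$; it is given below its vector space
    structure, its norm [direct_sum_norm] and a proof of completeness. *)
Record direct_sum (X : normedModType R) (E : unconditional1 Z) := DirectSum {
  direct_sum_val :> nat -> X;
  direct_sum_valP : direct_sum_val \in summable_seq E
}.

Context {X : normedModType R} {E : unconditional1 Z}.

Lemma summable_submod : submod_closed (summable_seq (X := X) E).
Proof.
have scalec (r : R) (x : nat -> X) : x \in summable_seq E ->
    r *: x \in summable_seq E.
  move=> /asboolP xc; apply/asboolP.
  rewrite (_ : series _ = `|r| \*: series (fun n => `|x n| *: E n)).
    exact: is_cvgZr.
  apply/funext => n; rewrite /series/= scaler_sumr.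
  by apply: eq_bigr => i _; rewrite normrZ scalerA.
split.
  apply/asboolP; rewrite (_ : series _ = cst 0); first exact: is_cvg_cst.
  by apply/funext => n; rewrite /series/= big1// => i _; rewrite normr0 scale0r.
move=> r x y /(scalec r) /asboolP xc /asboolP yc; apply/asboolP.
apply: (@unconditional1_cvg _ _ _ _ (fun i => `|(r *: x) i| + `|y i|)).
  by move=> i; rewrite normr_id ger0_norm ?addr_ge0// ler_normD.
rewrite (_ : series _ = series (fun n => `|(r *: x) n| *: E n) +
  series (fun n => `|y n| *: E n)); first exact: is_cvgD.
apply/funext => n; rewrite addrfctE /series/= -big_split/=.
by apply: eq_bigr => i _; rewrite scalerDl.
Qed.

HB.instance Definition _ := GRing.isSubmodClosed.Build R (nat -> X)
  (summable_seq (X := X) E) summable_submod.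
HB.instance Definition _ := [isSub for @direct_sum_val X E].
HB.instance Definition _ := [Choice of direct_sum X E by <:].
HB.instance Definition _ := [SubChoice_isSubLmodule of direct_sum X E by <:].

End direct_sum.

Section direct_sum_norm.
Context {R : realType} {Z : completeNormedModType R}.
Context {X : normedModType R} {E : unconditional1 Z}.
Implicit Types x y : direct_sum X E.

Definition direct_sum_norm x : R :=
  `|limn (series (fun n => `|x n| *: E n))|.

Lemma direct_sum_cvg x : cvgn (series (fun n => `|x n| *: E n)).
Proof. exact/asboolP/(direct_sum_valP x). Qed.

Lemma direct_sum_normD x y :
  direct_sum_norm (x + y) <= direct_sum_norm x + direct_sum_norm y.
Proof.
have xyE : series (fun n => (`|x n| + `|y n|) *: E n) =
    series (fun n => `|x n| *: E n) + series (fun n => `|y n| *: E n).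
  apply/funext => n; rewrite addrfctE /series/= -big_split/=.
  by apply: eq_bigr => i _; rewrite scalerDl.
rewrite /direct_sum_norm; apply: (le_trans _ (ler_normD _ _)).
rewrite -limD; [|exact: direct_sum_cvg|exact: direct_sum_cvg].
rewrite -xyE; apply: unconditional1_lim => [i|].
  by rewrite normr_id ger0_norm ?addr_ge0// ler_normD.
by rewrite xyE; apply: is_cvgD; exact: direct_sum_cvg.
Qed.

Lemma direct_sum_normZ (r : R) x :
  direct_sum_norm (r *: x) = `|r| * direct_sum_norm x.
Proof.
rewrite /direct_sum_norm (_ : series _ = `|r| \*: series (fun n => `|x n| *: E n)).
  by rewrite limZr ?normrZ ?normr_id//; exact: direct_sum_cvg.
apply/funext => n; rewrite /series/= scaler_sumr.
by apply: eq_bigr => i _; rewrite normrZ scalerA.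
Qed.

Lemma direct_sum_coord x n : `|x n| * `|E n| <= direct_sum_norm x.
Proof.
have := unconditional1_coord (a := fun i => `|x i|) n (@direct_sum_cvg x).
by rewrite normr_id.
Qed.

Lemma direct_sum_norm0 x : direct_sum_norm x = 0 -> x = 0.
Proof.
move=> x0; apply/val_inj/funext => n; apply/eqP.
have := direct_sum_coord x n; rewrite x0 pmulr_lle0 ?normr_le0//.
by rewrite normr_gt0 unconditional1_neq0.
Qed.

HB.instance Definition _ := Lmodule_isNormed.Build R (direct_sum X E)
  direct_sum_normD direct_sum_normZ direct_sum_norm0.

End direct_sum_norm.

Section direct_sum_complete.
Context {R : realType} {Z : completeNormedModType R}.
Context {X : completeNormedModType R} {E : unconditional1 Z}.

Let partial (x : nat -> X) N := \sum_(0 <= i < N) `|x i| *: E i.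

Let partial_le (x : direct_sum X E) N : `|partial x N| <= `|x|.
Proof.
have xc := @direct_sum_cvg _ _ _ _ x.
rewrite [leRHS](_ : _ = `|limn (series (fun n => `|x n| *: E n))|)// -lim_norm//.
apply: limr_ge; first exact: is_cvg_norm.
exists N => // k /= Nk; rewrite /series/= /partial.
pose c i := if (i < N)%N then `|x i| else 0.
rewrite (_ : \sum_(0 <= i < N) _ = \sum_(0 <= i < k) c i *: E i).
  by apply: unconditional1_le => i; rewrite /c; case: ifP; rewrite ?normr0.
rewrite [RHS](@big_cat_nat _ _ _ N)//= [X in _ = _ + X]big_nat.
rewrite [X in _ = _ + X]big1 ?addr0.
  by apply: eq_big_nat => i /andP[_ iN]; rewrite /c iN.
by move=> i /andP[Ni _]; rewrite /c ltnNge Ni scale0r.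
Qed.

Lemma direct_sum_complete (F : set_system (direct_sum X E)) :
  ProperFilter F -> cauchy F -> cvg F.
Proof.
move=> FF /cauchyP Fc.
have coordc n : cvg ((fun x : direct_sum X E => x n) @ F).
  apply: cauchy_cvg; apply/cauchyP => e e0.
  have En0 : 0 < `|E n| by rewrite normr_gt0 unconditional1_neq0.
  have [x Fx] := Fc _ (mulr_gt0 e0 En0).
  exists (x n); apply: (@filterS _ F _ _ _ _ Fx) => y.
  rewrite /= -!ball_normE/= => xy.
  have := le_lt_trans (direct_sum_coord (x - y) n) xy.
  by rewrite ltr_pM2r.
pose l n := lim ((fun x : direct_sum X E => x n) @ F).
have Fl (e : R) : 0 < e -> exists2 x : direct_sum X E,
    F (ball x e) & forall N, `|partial (fun i => x i - l i) N| <= e.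
  move=> e0; have [x Fx] := Fc _ e0; exists x => // N.
  have pc : (fun y : direct_sum X E => `|partial (fun i => x i - y i) N|) @ F -->
      `|partial (fun i => x i - l i) N|.
    apply: cvg_norm; rewrite /partial; elim: N => [|N IH].
      by under eq_fun do rewrite big_geq//; rewrite big_geq//; exact: cvg_cst.
    under eq_fun do rewrite big_nat_recr//=.
    rewrite big_nat_recr//=; apply: cvgD; first exact: IH.
    apply: cvgZr_tmp; apply: cvg_norm; apply: cvgB; first exact: cvg_cst.
    exact: coordc.
  apply: (cvgr_to_le pc); apply: (@filterS _ F _ _ _ _ Fx) => y.
  rewrite /= -ball_normE/= => xy.
  by rewrite (le_trans (partial_le (x - y) N))// ltW.
have tail (x : nat -> X) m n :
    `|\sum_(m <= i < n) `|x i| *: E i| <= `|partial x n|.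
  pose c i := if (m <= i)%N then `|x i| else 0.
  rewrite (_ : \sum_(m <= i < n) _ = \sum_(0 <= i < n) c i *: E i).
    by apply: unconditional1_le => i; rewrite /c; case: ifP; rewrite ?normr0.
  have [mn|nm] := leqP m n.
    rewrite [RHS](@big_cat_nat _ _ _ m)//= [X in _ = X + _]big_nat.
    rewrite [X in _ = X + _]big1 ?add0r.
      by apply: eq_big_nat => i /andP[mi _]; rewrite /c mi.
    by move=> i /andP[_ im]; rewrite /c leqNgt im scale0r.
  rewrite [LHS]big_geq ?(ltnW nm)// [RHS]big_nat [RHS]big1// => i /andP[_ im].
  by rewrite /c leqNgt (ltn_trans im nm) scale0r.
have lS : l \in summable_seq E.
  apply/asboolP/cauchy_cvgP/cauchy_seriesP => e e0.
  have e20 : 0 < e / 2 by rewrite divr_gt0.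
  have [x _ xl] := Fl _ e20.
  have /cauchy_cvgP/cauchy_seriesP/(_ _ e20) := @direct_sum_cvg _ _ _ _ x.
  apply: filterS => -[m n]/= xe.
  have le1 : `|\sum_(m <= i < n) `|l i| *: E i| <=
      `|\sum_(m <= i < n) (`|x i - l i| + `|x i|) *: E i|.
    apply: unconditional1_le => i; rewrite normr_id ger0_norm ?addr_ge0//.
    by rewrite -[X in `|X| <= _](subKr (x i)) (le_trans (ler_normB _ _))// addrC.
  apply: (le_lt_trans le1).
  under eq_bigr do rewrite scalerDl.
  rewrite big_split/= (le_lt_trans (ler_normD _ _))// [ltRHS]splitr.
  by rewrite ler_ltD// (le_trans (tail (fun i => x i - l i) m n)).
pose L : direct_sum X E := DirectSum lS.
apply/cvg_ex; exists L; apply/cvgrPdist_le => e e0.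
have e20 : 0 < e / 2 by rewrite divr_gt0.
have [x Fx xl] := Fl _ e20.
apply: filterS Fx => y; rewrite -ball_normE/= => xy.
have xL : `|x - L| <= e / 2.
  rewrite [leLHS](_ : _ = `|limn (series (fun n => `|(x - L) n| *: E n))|)//.
  have xLc := @direct_sum_cvg _ _ _ _ (x - L).
  rewrite -lim_norm//; apply: limr_le; first exact: is_cvg_norm.
  by apply: nearW => N; exact: xl.
rewrite [leRHS]splitr (le_trans (ler_distD x _ _))//.
by rewrite lerD ?(ltW xy)// distrC.
Qed.

HB.instance Definition _ :=
  Uniform_isComplete.Build (direct_sum X E) direct_sum_complete.

End direct_sum_complete.

(* Main.v *)
Require Import Defs.
From mathcomp Require Import all_boot all_order all_algebra.
From mathcomp Require Import all_classical all_reals all_analysis.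
From mathcomp Require Import ring lra.

Set Implicit Arguments.
Unset Strict Implicit.
Unset Printing Implicit Defensive.

Import Order.TTheory GRing.Theory Num.Theory.
Import numFieldNormedType.Exports.

Local Open Scope classical_set_scope.
Local Open Scope ring_scope.

(** Applying a map [f : X -> Y] in every coordinate does not work: a coarse or
    uniformly continuous map between normed spaces satisfies
    [|f x - f y| <= L |x - y| + C] (subdivide the segment from [x] to [y]), and
    the constant [C], repeated in infinitely many coordinates, need not be
    summable in [E]. The remedy is to zoom out as [n] grows and use
    [f_n(x) = 2^-n f(2^n x)] in coordinate [n]. This rescaling keeps [L] and
    divides [C] by [2^n], so that, [E] being normalized and 1-unconditional,
    [F(x) = (f_n(x_n))_n] is a well defined map between the direct sums with
    [|F x - F y| <= L |x - y| + 2 C] ([direct_sum_le]).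

    Everything else is transferred from [f] to [F] coordinate by coordinate,
    because [g o f = id] gives [g_n o f_n = id], and a bound [M] on the distance
    between [h o f] and the identity becomes the summable bound [2^-n M].

    - Coarse equivalences are the maps that satisfy the displayed inequality and
      have an inverse up to bounded distance satisfying it as well
      ([coarse_equivalenceP]); both halves lift.
    - For the continuity or uniform continuity of [F], the coordinates [n >= N]
      contribute at most [L |x - y| + 2 C / 2^N], where the last term is small
      for [N] large, and the finitely many other coordinates are controlled by
      the continuity of [f]. The two cases are one statement about convergence
      to 0 along an arbitrary filter ([direct_sum_dominated_cvg0]). A
      homeomorphism which is a coarse equivalence has an inverse that satisfies
      the displayed inequality ([coarse_equivalence_inverse]), so the inverse
      lifts too. *)

(** * Coarse maps between normed spaces *)

Section large_scale_lipschitz.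
Context {R : realType}.
Implicit Types V W : normedModType R.

Definition large_scale_lipschitz V W (f : V -> W) : Prop :=
  exists L C : R, [/\ 0 <= L, 0 <= C &
    forall x y, `|f x - f y| <= L * `|x - y| + C].

(** A segment of length at most [n d] is cut into [n] pieces of length at most
    [d], and [f] moves the ends of each piece by at most [K]. *)
Lemma locally_bounded_large_scale_lipschitz V W (f : V -> W) (d K : R) :
  0 < d -> 0 <= K ->
  (forall x y, `|x - y| <= d -> `|f x - f y| <= K) -> large_scale_lipschitz f.
Proof.
move=> d0 K0 fK.
have chain n x y : `|x - y| <= n.+1%:R * d -> `|f x - f y| <= n.+1%:R * K.
  elim: n x y => [|n IH] x y xy; first by rewrite mul1r fK// -[d]mul1r.
  (* The first of [n + 2] equal pieces of the segment goes from [x] to [z]. *)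
  pose z := x - n.+2%:R^-1 *: (x - y).
  have n0 : (n.+2%:R : R) != 0 by rewrite pnatr_eq0.
  have xz : `|x - z| <= d.
    rewrite /z subKr normrZ ger0_norm ?invr_ge0//.
    by rewrite ler_pdivrMl.
  have zy : `|z - y| <= n.+1%:R * d.
    have -> : z - y = (n.+1%:R / n.+2%:R) *: (x - y).
      have -> : n.+1%:R / n.+2%:R = 1 - n.+2%:R^-1 :> R.
        by apply: (mulIf n0); rewrite divfK// mulrBl mul1r mulVf//
          -[in RHS]natr1 addrK.
      by rewrite scalerBl scale1r /z addrAC.
    rewrite normrZ ger0_norm ?divr_ge0// -mulrA ler_wpM2l//.
    by rewrite ler_pdivrMl.
  rewrite (le_trans (ler_distD (f z) _ _))//.
  by rewrite -natr1 mulrDl mul1r addrC lerD ?fK ?IH.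
exists (K / d), K; split; [exact: divr_ge0 (ltW d0)|by []|] => x y.
pose n := Num.truncn (`|x - y| / d).
have q0 : 0 <= `|x - y| / d by rewrite divr_ge0// ltW.
have /andP[nq qn] := truncn_itv q0.
apply: (le_trans (chain n x y _)).
  by rewrite -ler_pdivrMr// ltW.
rewrite -natr1 mulrDl mul1r lerD2r mulrC -mulrA.
by rewrite ler_wpM2l// mulrC.
Qed.

Lemma coarse_large_scale_lipschitz V W (f : V -> W) :
  coarse f -> large_scale_lipschitz f.
Proof.
move=> /(_ 1 ler01); set m := modulus f 1 => m1.
have fm x y : `|x - y| <= 1 -> ((`|f x - f y|)%:E <= m)%E.
  by move=> xy; apply: ereal_sup_ubound; exists (x, y).
apply: (@locally_bounded_large_scale_lipschitz _ _ f 1 (fine m)) => //.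
  by rewrite fine_ge0// (le_trans _ (fm 0 0 _))// ?lee_fin// subrr normr0.
move=> x y /fm; rewrite -lee_fin fineK// fin_numE (lt_eqF m1) andbT.
have : (0 <= m)%E by rewrite (le_trans _ (fm 0 0 _)) ?lee_fin// subrr normr0.
by case: m {m1 fm}.
Qed.

Lemma large_scale_lipschitz_coarse V W (f : V -> W) :
  large_scale_lipschitz f -> coarse f.
Proof.
move=> [L [C [L0 C0 fLC]]] t t0; apply: (@le_lt_trans _ _ (L * t + C)%:E).
  apply: ge_ereal_sup => _ [[x y] /= xy <-]; rewrite lee_fin.
  by rewrite (le_trans (fLC x y))// lerD2r ler_wpM2l.
exact: ltry.
Qed.

(** A coarse inverse [h] turns the lower bound that expansion gives on [f] into
    an upper bound on [h]. The conditions on the right are plain inequalities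
    between norms, which can be rescaled and summed over coordinates. *)
Lemma coarse_equivalenceP V W (f : V -> W) :
  coarse_equivalence f <->
  large_scale_lipschitz f /\ exists h : W -> V,
    [/\ large_scale_lipschitz h,
        exists M : R, forall x, `|x - h (f x)| <= M &
        exists M : R, forall y, `|y - f (h y)| <= M].
Proof.
split=> [[fc fe fb]|[fl [h [[L [C [L0 C0 hLC]]] [M hM] [K fK]]]]].
  split; first exact: coarse_large_scale_lipschitz.
  have fexp (A : R) : exists B : R,
      forall x y, `|f x - f y| < A -> `|x - y| <= B.
    have /cvgeyPge/(_ A) [B [_ fB]] := fe.
    exists B => x y xyA; rewrite leNgt; apply/negP => /fB /= Axy.
    have : (comodulus f `|x - y|%R <= (`|f x - f y|)%:E)%E.
      by apply: ereal_inf_lbound; exists (x, y) => /=.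
    by move=> /(le_trans Axy); rewrite lee_fin leNgt xyA.
  have [M fM] : exists M : R, forall y, exists x, `|y - f x| < M.
    move: fb; rewrite /cobounded; set s := ereal_sup _ => s_lty.
    exists (fine s + 1) => y.
    have ys : (ereal_inf [set (`|y - f x|)%:E | x in [set: V]] <= s)%E.
      by apply: ereal_sup_ubound; exists y.
    have s0 : (0 <= s)%E.
      apply: le_trans ys; apply: le_ereal_inf_tmp => _ [x _ <-].
      by rewrite lee_fin.
    have sfin : s \is a fin_num by rewrite ge0_fin_numE.
    have /ereal_inf_lt[_ [x _ <-]] :
        (ereal_inf [set (`|y - f x|)%:E | x in [set: V]] < (fine s + 1)%:E)%E.
      by apply: le_lt_trans ys _; rewrite EFinD fineK// lteDl// lte01.
    by rewrite lte_fin; exists x.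
  have [h hM] := choice fM.
  have M0 : 0 < M by exact: le_lt_trans (hM 0).
  exists h; split.
  - have [K fK] := fexp (M + 1 + M).
    apply: (@locally_bounded_large_scale_lipschitz _ _ h 1 K) => //.
      have := fK 0 0; rewrite !subrr !normr0; apply; lra.
    move=> y z yz; apply: fK.
    have := ler_distD z (f (h y)) (f (h z)).
    have := ler_distD y (f (h y)) z; rewrite [`|f _ - y|]distrC.
    have := hM y; have := hM z; lra.
  - have [K fK] := fexp M.
    by exists K => x; apply: fK.
  - by exists M => y; rewrite ltW.
split; first exact: large_scale_lipschitz_coarse.
  have low x y : `|x - y| <= L * `|f x - f y| + (M + C + M).
    have := ler_distD (h (f x)) x y; have := ler_distD (h (f y)) (h (f x)) y.
    rewrite [`|h (f y) - y|]distrC.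
    have := hLC (f x) (f y); have := hM x; have := hM y; lra.
  rewrite /expanding; apply/cvgeyPge => A; exists (L * `|A| + (M + C + M)).
  split; first exact: num_real.
  move=> t /= tL.
  apply: le_ereal_inf_tmp => _ [[x y] /= xyt <-]; rewrite lee_fin.
  rewrite (le_trans (ler_norm A))// leNgt; apply/negP => /ltW fA.
  have := low x y; have := ler_wpM2l L0 fA; lra.
apply: (@le_lt_trans _ _ K%:E); last exact: ltry.
apply: ge_ereal_sup => _ [y _ <-].
apply: (@le_trans _ _ (`|y - f (h y)|)%:E); last by rewrite lee_fin.
by apply: ereal_inf_lbound; exists (h y).
Qed.

End large_scale_lipschitz.

(** * Domination in direct sums *)

Section domination.
Context {R : realType} {Z : completeNormedModType R} {E : unconditional1 Z}.
Context (normalizedE : forall n : nat, `|E n| = 1).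
Implicit Types V W : normedModType R.

Lemma normalized_coord_le V (v : direct_sum V E) n : `|v n| <= `|v|.
Proof. by have := direct_sum_coord v n; rewrite normalizedE mulr1. Qed.

Lemma direct_sum_eq V (x y : direct_sum V E) : x =1 y -> x = y.
Proof. by move=> xy; apply/val_inj/funext. Qed.

Lemma direct_sum_subE V (x y : direct_sum V E) n : (x - y) n = x n - y n.
Proof. by []. Qed.

Lemma normalized_cvg (b : nat -> R) (B : R) :
  (forall n, 0 <= b n) -> (forall n, \sum_(i < n) b i <= B) ->
  cvgn (series (fun n => b n *: E n)) /\
  `|limn (series (fun n => b n *: E n))| <= B.
Proof.
move=> b0 bB.
have normE n : `|b n *: E n| = b n.
  by rewrite normrZ normalizedE mulr1 ger0_norm.
have bc : cvgn (series (fun n => b n *: E n)).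
  apply: normed_cvg; rewrite /=.
  have -> : [normed series (fun n => b n *: E n)] = series b.
    by congr series; apply/funext.
  apply: nondecreasing_is_cvgn; first exact: nondecreasing_series.
  by exists B => _ [n _ <-]; rewrite /series/= big_mkord.
split=> //; rewrite -lim_norm//; apply: limr_le; first exact: is_cvg_norm.
apply: nearW => n; rewrite /series/= (le_trans (ler_norm_sum _ _ _))//.
by under eq_bigr do rewrite normE; rewrite big_mkord.
Qed.

(** Unconditionality compares the series of [|u n|] with the sum of two
    convergent series: a multiple of that of [v], and that of [b], which
    converges absolutely because the [E n] have norm 1. *)
Lemma dominated_seq V W (L B : R) (v : direct_sum V E) (b : nat -> R)
    (u : nat -> W) :
  0 <= L -> (forall n, 0 <= b n) -> (forall n, \sum_(i < n) b i <= B) ->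
  (forall n, `|u n| <= L * `|v n| + b n) ->
  exists2 x : direct_sum W E, x =1 u & `|x| <= L * `|v| + B.
Proof.
move=> L0 b0 bB uvb; have [bc bE] := normalized_cvg b0 bB.
have vc := direct_sum_cvg (x := v).
pose a n := L * `|v n| + b n.
have ua n : `| `|u n| | <= `|a n|.
  by rewrite normr_id (le_trans (uvb n))// ler_norm.
have aE : series (fun n => a n *: E n) =
    L \*: series (fun n => `|v n| *: E n) + series (fun n => b n *: E n).
  apply/funext => n; rewrite addrfctE /series/= scaler_sumr -big_split/=.
  by apply: eq_bigr => i _; rewrite scalerDl scalerA.
have Lvc : cvgn (L \*: series (fun n => `|v n| *: E n)) by exact: is_cvgZr.
have ac : cvgn (series (fun n => a n *: E n)) by rewrite aE; exact: is_cvgD.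
have uS : u \in summable_seq E by apply/asboolP; exact: unconditional1_cvg ac.
exists (DirectSum uS) => //.
apply: (le_trans (unconditional1_lim ua ac)).
rewrite aE limD// (le_trans (ler_normD _ _))// lerD// limZr//.
by rewrite normrZ ger0_norm.
Qed.

(** The geometric tail is [C/2^N + C/2^(N+1) + ... <= 2 C / 2^N]. *)
Lemma head_tail_sum_le (C : R) (N : nat) (a : nat -> R) n : 0 <= C ->
  (forall i, 0 <= a i) ->
  \sum_(i < n) (if (i < N)%N then a i else C / 2 ^+ i) <=
  \sum_(i < N) a i + 2 * C / 2 ^+ N.
Proof.
move=> C0 a0; pose b i := if (i < N)%N then a i else C / 2 ^+ i.
change (\sum_(i < n) b i <= \sum_(i < N) a i + 2 * C / 2 ^+ N).
have b0 i : 0 <= b i by rewrite /b; case: ifP => // _; exact: divr_ge0.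
have bE m : \sum_(0 <= i < N + m) b i =
    \sum_(0 <= i < N) a i + 2 * C / 2 ^+ N * (1 - (2 ^+ m)^-1).
  elim: m => [|m IH].
    rewrite addn0 expr0 invr1 subrr mulr0 addr0.
    by apply: eq_big_nat => i /andP[_ iN]; rewrite /b iN.
  rewrite addnS big_nat_recr//= IH -addrA; congr (_ + _).
  rewrite /b ltnNge leq_addr/= exprD [2 ^+ m.+1]exprS.
  by field; rewrite !expf_neq0.
rewrite -(big_mkord xpredT b) -(big_mkord xpredT a).
apply: (@le_trans _ _ (\sum_(0 <= i < N + n) b i)).
  by rewrite [leRHS](@big_cat_nat _ _ _ n)//= ?leq_addl// lerDl sumr_ge0.
by rewrite bE lerD2l ler_piMr ?divr_ge0 ?mulr_ge0// gerBl invr_ge0.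
Qed.

(** The norm estimate behind the whole construction. [N = 0] gives the bound
    [L |v| + 2 C] of large-scale geometry; a large [N] makes the constant small
    at the price of finitely many coordinates of [u], which is what continuity
    requires. *)
Lemma direct_sum_le V W (L C : R) (v : direct_sum V E) (u : nat -> W) :
  0 <= L -> 0 <= C -> (forall n, `|u n| <= L * `|v n| + C / 2 ^+ n) ->
  exists2 x : direct_sum W E, x =1 u & forall N,
    `|x| <= L * `|v| + (\sum_(i < N) `|u i| + 2 * C / 2 ^+ N).
Proof.
move=> L0 C0 uLC.
have dom N : exists2 x : direct_sum W E, x =1 u &
    `|x| <= L * `|v| + (\sum_(i < N) `|u i| + 2 * C / 2 ^+ N).
  apply: (@dominated_seq _ _ _ _ _ (fun i => if (i < N)%N then `|u i|
    else C / 2 ^+ i)) => // n.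
  - by case: ifP => // _; rewrite divr_ge0.
  - exact: (@head_tail_sum_le C N (fun i => `|u i|)).
  - by case: ifP => // _; rewrite lerDr mulr_ge0.
have [x xu _] := dom 0; exists x => // N; have [y yu yN] := dom N.
suff -> : x = y by [].
by apply: direct_sum_eq => n; rewrite xu yu.
Qed.

(** An analogue of dominated convergence: coordinatewise convergence to 0
    implies convergence in norm, the domination being up to a norm that tends
    to 0. The filter is arbitrary so that neighbourhoods of a point and
    entourages are both covered. *)
Lemma direct_sum_dominated_cvg0 V W (T : Type) (G : set_system T)
    (FG : Filter G) (L C : R) (v : T -> direct_sum V E) (u : T -> direct_sum W E) :
  0 <= L -> 0 <= C -> (forall t n, `|u t n| <= L * `|v t n| + C / 2 ^+ n) ->
  v @ G --> (0 : direct_sum V E) -> (forall n, u^~ n @ G --> (0 : W)) ->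
  u @ G --> (0 : direct_sum W E).
Proof.
move=> L0 C0 uLC v0 u0; apply/cvgr0Pnorm_lt => e e0.
have uN t N : `|u t| <= L * `|v t| + (\sum_(i < N) `|u t i| + 2 * C / 2 ^+ N).
  have [x xu] := direct_sum_le L0 C0 (uLC t).
  suff -> : x = u t by [].
  exact: direct_sum_eq.
(* [2^N > N], so any [N > 2 C / (e / 2)] works. *)
have [N CN] : exists N, 2 * C / 2 ^+ N < e / 2.
  exists (Num.truncn (2 * C / (e / 2))).+1; rewrite ltr_pdivrMr ?exprn_gt0//.
  rewrite [ltRHS]mulrC -ltr_pdivrMr ?divr_gt0//.
  apply: (lt_trans (truncnS_gt _)).
  by rewrite -natrX ltr_nat ltn_expl.
have head : (fun t => L * `|v t| + \sum_(i < N) `|u t i|) @ G --> (0 : R).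
  have sum0 : (fun t => \sum_(i < N) `|u t i|) @ G --> (0 : R).
    elim: N {CN} => [|N IH].
      by under eq_fun do rewrite big_ord0; exact: cvg_cst.
    under eq_fun do rewrite big_ord_recr/=.
    have /(_ FG) uN0 := cvg_norm (u0 N); rewrite normr0 in uN0.
    by have := cvgD IH uN0; rewrite addr0; apply.
  have v0n : (fun t => `|v t|) @ G --> (0 : R).
    by have /(_ FG) := cvg_norm v0; rewrite normr0.
  have /(_ FG) Lv0 := cvgMl_tmp (a := L) v0n.
  by have /(_ FG) := cvgD Lv0 sum0; rewrite mulr0 addr0.
have e20 : 0 < e / 2 by rewrite divr_gt0.
move/cvgr0Pnorm_lt/(_ _ e20): head; apply: filterS => t.
rewrite ger0_norm ?addr_ge0 ?mulr_ge0 ?sumr_ge0// => he.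
by have := uN t N; lra.
Qed.

End domination.

(** * Continuity as convergence of differences to 0 *)

Section uniform_continuity.
Context {R : realType}.
Implicit Types V W : normedModType R.

Lemma entourage_sub_cvg0 V :
  (fun p : V * V => p.1 - p.2) @ entourage --> (0 : V).
Proof.
apply/cvgr0Pnorm_lt => e e0; rewrite -entourage_from_ballE.
by exists e => // p /=; rewrite -ball_normE.
Qed.

Lemma unif_continuousP V W (f : V -> W) :
  unif_continuous f <->
  (fun p : V * V => f p.1 - f p.2) @ entourage --> (0 : W).
Proof.
split=> [fu|/cvgr0Pnorm_lt f0].
  by apply: cvg_trans (@entourage_sub_cvg0 W) => A /fu.
move=> A; rewrite -entourage_from_ballE => -[e /= e0 eA].
have := f0 e e0; apply: filterS => p /= fp; apply: eA => /=.
by rewrite -ball_normE.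
Qed.

Lemma unif_continuous_cvg0 V W (f : V -> W) (T : Type) (G : set_system T)
    (FG : Filter G) (a b : T -> V) :
  unif_continuous f -> (fun t => a t - b t) @ G --> (0 : V) ->
  (fun t => f (a t) - f (b t)) @ G --> (0 : W).
Proof.
move=> /unif_continuousP/cvgr0Pnorm_lt f0 /cvgr0Pnorm_lt ab0.
apply/cvgr0Pnorm_lt => e /f0; rewrite -entourage_from_ballE => -[d /= d0 df].
apply: filterS (ab0 _ d0) => t abt; apply: (df (a t, b t)) => /=.
by rewrite -ball_normE.
Qed.

Lemma unif_continuous_large_scale_lipschitz V W (f : V -> W) :
  unif_continuous f -> large_scale_lipschitz f.
Proof.
move=> /unif_continuousP/cvgr0Pnorm_lt/(_ _ ltr01).
rewrite -entourage_from_ballE => -[d /= d0 df].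
apply: (@locally_bounded_large_scale_lipschitz _ _ _ f (d / 2) 1) => //.
  by rewrite divr_gt0.
move=> x y xy; rewrite ltW//; apply: (df (x, y)).
rewrite /= -ball_normE/=; lra.
Qed.

Lemma continuous_sub_cvg0 V W (f : V -> W) :
  continuous f <-> forall x, (fun y => f x - f y) @ x --> (0 : W).
Proof.
split=> [fc x|f0 x].
  rewrite -(subrr (f x)); apply: cvgB; [exact: cvg_cst|exact: fc].
by apply/cvgrPdist_lt => e e0; move/cvgr0Pnorm_lt/(_ _ e0): (f0 x).
Qed.

End uniform_continuity.

(** * Lifting maps to direct sums *)

Section lift.
Context {R : realType} {Z : completeNormedModType R} {E : unconditional1 Z}.
Context (normalizedE : forall n : nat, `|E n| = 1).
Implicit Types V W : normedModType R.

(** A predicate on [F] rather than a function of [f]: a lift exists only under a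
    summability condition, and every later argument uses this equation alone. *)
Definition is_lift V W (f : V -> W) (F : direct_sum V E -> direct_sum W E) :
    Prop :=
  forall x n, F x n = (2 ^+ n)^-1 *: f (2 ^+ n *: x n).

(** Rescaling by [2^n] divides the additive constant by [2^n] and leaves the
    slope unchanged. *)
Lemma rescaled_le V W (f : V -> W) (L C : R) n (x y : V) :
  (forall x y, `|f x - f y| <= L * `|x - y| + C) ->
  `|(2 ^+ n)^-1 *: f (2 ^+ n *: x) - (2 ^+ n)^-1 *: f (2 ^+ n *: y)| <=
  L * `|x - y| + C / 2 ^+ n.
Proof.
move=> fLC; rewrite -scalerBr normrZ ger0_norm ?invr_ge0//.
rewrite ler_pdivrMl// (le_trans (fLC _ _))// -scalerBr normrZ.
by rewrite ger0_norm// mulrDr mulrCA [2 ^+ n * (C / _)]mulrC divfK ?expf_neq0.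
Qed.

(** Since [f 0] may be nonzero, [f_n] maps 0 to [2^-n f 0]; this geometric term
    is absorbed in the constant. *)
Lemma lift_exists V W (f : V -> W) :
  large_scale_lipschitz f -> exists F, is_lift f F.
Proof.
move=> [L [C [L0 C0 fLC]]].
suff /choice[F FE] : forall x : direct_sum V E, exists y : direct_sum W E,
    forall n, y n = (2 ^+ n)^-1 *: f (2 ^+ n *: x n) by exists F.
move=> x.
have f0C : 0 <= C + `|f 0| by rewrite addr_ge0.
have [|y yE _] := @direct_sum_le _ _ _ normalizedE _ _ _ _ x
  (fun n => (2 ^+ n)^-1 *: f (2 ^+ n *: x n)) L0 f0C; last by exists y.
move=> n; have := @rescaled_le _ _ f _ _ n (x n) 0 fLC.
rewrite scaler0 subr0 mulrDl => fn.
rewrite addrA; apply: le_trans (lerD fn (lexx _)).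
set a := _ *: _; set b := _ *: _.
have -> : `|f 0| / 2 ^+ n = `|b|.
  by rewrite normrZ mulrC ger0_norm ?invr_ge0.
by rewrite -[X in `|X| <= _](subrK b) ler_normD.
Qed.

Lemma lift_large_scale_lipschitz V W (f : V -> W) F :
  large_scale_lipschitz f -> is_lift f F -> large_scale_lipschitz F.
Proof.
move=> [L [C [L0 C0 fLC]]] FE; exists L, (2 * C); split => [//||x y].
  exact: mulr_ge0.
have [|z zE zC] := @direct_sum_le _ _ _ normalizedE _ _ _ _ (x - y)
  (fun n => (F x - F y) n) L0 C0.
  by move=> n; rewrite !direct_sum_subE !FE; exact: rescaled_le.
have -> : F x - F y = z by apply: direct_sum_eq => n; rewrite zE.
by have := zC 0; rewrite big_ord0 add0r expr0 divr1.
Qed.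

(** In coordinate [n] the distance between the identity and [f_n o h_n] is
    2^-n times a distance between the identity and [f o h]. *)
Lemma lift_quasi_inverse V W (f : V -> W) (h : W -> V) F H :
  is_lift f F -> is_lift h H ->
  (exists M : R, forall y, `|y - f (h y)| <= M) ->
  exists M : R, forall y, `|y - F (H y)| <= M.
Proof.
move=> FE HE [M fM]; exists (2 * M) => y.
have M0 : 0 <= M by exact: le_trans (fM 0).
have [|z zE zM] := @direct_sum_le _ _ _ normalizedE _ _ _ _ (0 : direct_sum W E)
  (fun n => (y - F (H y)) n) (lexx 0) M0.
  move=> n; rewrite mul0r add0r direct_sum_subE FE HE scalerA.
  rewrite mulfV ?expf_neq0// scale1r.
  rewrite -[X in X - _](scalerK (_ : 2 ^+ n != 0)) ?expf_neq0//.
  rewrite -scalerBr normrZ ger0_norm ?invr_ge0// mulrC.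
  by rewrite ler_wpM2r ?invr_ge0.
have -> : y - F (H y) = z by apply: direct_sum_eq => n; rewrite zE.
by have := zM 0; rewrite big_ord0 add0r expr0 divr1 mul0r add0r.
Qed.

Lemma lift_cancel V W (f : V -> W) (g : W -> V) F G :
  is_lift f F -> is_lift g G -> cancel f g -> cancel F G.
Proof.
move=> FE GE fg x; apply: direct_sum_eq => n.
by rewrite GE FE scalerA mulfV ?expf_neq0// scale1r fg scalerK ?expf_neq0.
Qed.

Lemma lift_cvg0 V W (f : V -> W) F (T : Type) (G : set_system T)
    (FG : Filter G) (a b : T -> direct_sum V E) :
  large_scale_lipschitz f -> is_lift f F ->
  (fun t => a t - b t) @ G --> (0 : direct_sum V E) ->
  (forall n, (fun t => f (2 ^+ n *: a t n) - f (2 ^+ n *: b t n)) @ G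
     --> (0 : W)) ->
  (fun t => F (a t) - F (b t)) @ G --> (0 : direct_sum W E).
Proof.
move=> [L [C [L0 C0 fLC]]] FE ab0 fab0.
apply: (direct_sum_dominated_cvg0 normalizedE _ L0 C0 _ ab0).
  by move=> t n; rewrite !direct_sum_subE !FE; exact: rescaled_le.
move=> n; under eq_fun do rewrite direct_sum_subE !FE -scalerBr.
have /(_ FG) := cvgZl_tmp (k := (2 ^+ n)^-1) (fab0 n).
by rewrite scaler0; apply.
Qed.

(** For a fixed [n] the factor [2^n] is harmless: the direct sum controls each
    coordinate, although not uniformly in [n] after rescaling. *)
Lemma coord_cvg0 V (T : Type) (G : set_system T) (FG : Filter G)
    (v : T -> direct_sum V E) n :
  v @ G --> (0 : direct_sum V E) -> (fun t => 2 ^+ n *: v t n) @ G --> (0 : V).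
Proof.
move=> v0; suff vn0 : (fun t => v t n) @ G --> (0 : V).
  by have /(_ FG) := cvgZl_tmp (k := 2 ^+ n) vn0; rewrite scaler0; apply.
apply/cvgr0Pnorm_lt => e e0; move/cvgr0Pnorm_lt/(_ _ e0): v0.
by apply: filterS => t; apply: le_lt_trans; exact: normalized_coord_le.
Qed.

Lemma lift_continuous V W (f : V -> W) F :
  large_scale_lipschitz f -> is_lift f F -> continuous f -> continuous F.
Proof.
move=> fl FE fc.
have sub0 (x : direct_sum V E) : (fun y => x - y) @ x --> (0 : direct_sum V E).
  by apply: (continuous_sub_cvg0 idfun).1 => y; exact: cvg_id.
have coordc n : continuous (fun x : direct_sum V E => 2 ^+ n *: x n).
  apply/continuous_sub_cvg0 => x.
  under eq_fun do rewrite -scalerBr -direct_sum_subE.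
  exact: (coord_cvg0 _ n (sub0 x)).
apply/continuous_sub_cvg0 => x; apply: (lift_cvg0 _ fl FE (sub0 x)) => n.
apply: (continuous_sub_cvg0 (f \o fun y : direct_sum V E => 2 ^+ n *: y n)).1.
by move=> y; apply: continuous_comp; [exact: coordc|exact: fc].
Qed.

Lemma lift_unif_continuous V W (f : V -> W) F :
  is_lift f F -> unif_continuous f -> unif_continuous F.
Proof.
move=> FE fu; apply/unif_continuousP.
apply: (lift_cvg0 _ _ FE); first exact: unif_continuous_large_scale_lipschitz.
  exact: entourage_sub_cvg0.
move=> n; apply: unif_continuous_cvg0 => //.
under eq_fun do rewrite -scalerBr.
exact: (coord_cvg0 _ n (@entourage_sub_cvg0 _ _)).
Qed.

Lemma lift_coarse_equivalence V W (f : V -> W) F :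
  is_lift f F -> coarse_equivalence f -> coarse_equivalence F.
Proof.
move=> FE /coarse_equivalenceP[fl [h [hl hf fh]]].
have [H HE] := lift_exists hl.
apply/coarse_equivalenceP; split; first exact: lift_large_scale_lipschitz FE.
exists H; split; first exact: lift_large_scale_lipschitz HE.
- exact: lift_quasi_inverse HE FE hf.
- exact: lift_quasi_inverse FE HE fh.
Qed.

End lift.

(** An exact inverse of [f] stays at bounded distance from any coarse inverse
    of [f], hence inherits its large-scale Lipschitz bound. *)
Lemma coarse_equivalence_inverse (R : realType) (V W : normedModType R)
    (f : V -> W) (g : W -> V) :
  coarse_equivalence f -> cancel g f -> large_scale_lipschitz g.
Proof.
move=> /coarse_equivalenceP[_ [h [[L [C [L0 C0 hLC]]] [M hM] _]]] gf.
have M0 : 0 <= M by exact: le_trans (hM 0).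
exists L, (M + C + M); split; [by []|by rewrite !addr_ge0|move=> x y].
have := hM (g x); have := hM (g y); rewrite !gf => yM xM.
have := ler_distD (h x) (g x) (g y); have := ler_distD (h y) (h x) (g y).
rewrite [`|h y - g y|]distrC.
have := hLC x y; lra.
Qed.

Theorem theorem1p9 (R : realType) (X Y Z : completeNormedModType R)
    (E : unconditional1 Z) (normalizedE : forall n : nat, `|E n| = 1) :
  [/\ coarsely_equivalent X Y ->
        coarsely_equivalent (direct_sum X E) (direct_sum Y E),
      uniformly_homeomorphic X Y ->
        uniformly_homeomorphic (direct_sum X E) (direct_sum Y E) &
      homeomorphically_coarsely_equivalent X Y ->
        homeomorphically_coarsely_equivalent (direct_sum X E) (direct_sum Y E)].
Proof.
split.
- move=> [f fce]; have /coarse_equivalenceP[fl _] := fce.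
  have [F FE] := lift_exists normalizedE fl.
  by exists F; exact: lift_coarse_equivalence FE fce.
- move=> [f [g [fg gf fu gu]]].
  have fl := unif_continuous_large_scale_lipschitz fu.
  have gl := unif_continuous_large_scale_lipschitz gu.
  have [F FE] := lift_exists normalizedE fl.
  have [G GE] := lift_exists normalizedE gl.
  exists F, G; split.
  + exact: lift_cancel FE GE fg.
  + exact: lift_cancel GE FE gf.
  + exact: lift_unif_continuous FE fu.
  + exact: lift_unif_continuous GE gu.
- move=> [f [[g [fg gf fc gc]] fce]]; have /coarse_equivalenceP[fl _] := fce.
  have gl := coarse_equivalence_inverse fce gf.
  have [F FE] := lift_exists normalizedE fl.
  have [G GE] := lift_exists normalizedE gl.
  exists F; split; last exact: lift_coarse_equivalence FE fce.
  exists G; split.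
  + exact: lift_cancel FE GE fg.
  + exact: lift_cancel GE FE gf.
  + exact: lift_continuous fl FE fc.
  + exact: lift_continuous gl GE gc.
Qed.
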